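(* Let $n>0$ be an integer and $a\in\{0,1\}$. Then \[ \sum_{0\le 3j\le n-a}\frac{(q^3;q^3)_{n-j-1}(1-q^{2n+a})\,q^{3j^2+3j}}{(q;q)_{n-3j-a}\,(q^6;q^6)_{j}} \;=\; \sum_{j=-\infty}^{\infty}(-1)^j q^{6j^2+3j}{2n+a\brack n-3j-a}_q . \]
   Context: For a non-negative integer $L$, $(a;q)_L=\prod_{k=0}^{L-1}(1-aq^k)$. For integers $m,n$, the $q$-binomial coefficient is ${m+n\brack n}_q=\frac{(q;q)_{m+n}}{(q;q)_m(q;q)_n}$ if $m,n\ge 0$ and $0$ otherwise. *)

(* Defs.v *)
From mathcomp Require Import all_boot all_order all_algebra.
From mathcomp Require Import mathcomp_extra boolp classical_sets fsbigop.
Set Implicit Arguments.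
Unset Strict Implicit.
Unset Printing Implicit Defensive.
Import Order.TTheory GRing.Theory Num.Theory.
Local Open Scope ring_scope.

(* (a; q)_L *)
Definition qpoch (F : fieldType) (a q : F) (L : nat) : F :=
  \prod_(0 <= k < L) (1 - a * q ^+ k).

(* [M, N]_q with integer entries, where the upper entry is the sum
   M = (M - N) + N; it is 0 unless both M - N and N are non-negative, in which
   case the absolute values below are mere casts from int to nat. *)
Definition qbinom (F : fieldType) (q : F) (M N : int) : F :=
  if (0 <= M - N) && (0 <= N) then
    qpoch q q `|M|%N / (qpoch q q `|M - N|%N * qpoch q q `|N|%N)
  else 0.

(* Main.v *)
Require Import Defs.
From mathcomp Require Import all_boot all_order all_algebra.
From mathcomp Require Import mathcomp_extra boolp classical_sets fsbigop.
From mathcomp Require Import zify ring.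
Set Implicit Arguments.
Unset Strict Implicit.
Unset Printing Implicit Defensive.
Import Order.TTheory GRing.Theory Num.Theory.
Local Open Scope ring_scope.

(* Put Q = q^3. The Gauss-type evaluation
     sum_j (-1)^j Q^(j^2 + (1-a) j) [2r+a, r-j]_Q
       = Q^((1-a) r) (Q;Q)_(2r+a) / (Q^2;Q^2)_r
   turns 1/(q^6;q^6)_r in the left-hand side into a bilateral sum over j.
   After exchanging the two sums, the inner sum over r = j + s is, with
   m = n - 3j - a and c = 2j + a, the q-Pfaff-Saalschuetz sum in base Q
     sum_s (Q;Q)_(m+c-s-1) Q^(s^2+cs) / ((q;q)_(m-3s) (Q;Q)_s (Q;Q)_(s+c))
       = (q;q)_(2m+3c-1) / ((q;q)_m (q;q)_(m+3c)),
   whose three numerator parameters q^(-m), q^(1-m), q^(2-m) have been merged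
   into (q;q)_(m-3s). In this form it satisfies a first-order recurrence in m,
   proved by a Wilf-Zeilberger certificate. *)

(** * Shifted factorials (q;q)_L for q not a root of unity *)

Lemma qpoch0 (F : fieldType) (a q : F) : qpoch a q 0 = 1.
Proof. by rewrite /qpoch big_geq. Qed.

Lemma qpochS (F : fieldType) (q : F) (L : nat) :
  qpoch q q L.+1 = qpoch q q L * (1 - q ^+ L.+1).
Proof. by rewrite /qpoch big_nat_recr //= exprS. Qed.

Lemma qpoch_neq0 (F : fieldType) (q : F) (L : nat) :
  (forall k : nat, (0 < k)%N -> q ^+ k != 1) -> qpoch q q L != 0.
Proof.
move=> hq; elim: L => [|L IH]; first by rewrite qpoch0 oner_eq0.
by rewrite qpochS mulf_neq0 // subr_eq0 eq_sym hq.
Qed.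

Lemma not_root_exp (F : fieldType) (q : F) (d : nat) :
  (0 < d)%N -> (forall k : nat, (0 < k)%N -> q ^+ k != 1) ->
  forall k : nat, (0 < k)%N -> (q ^+ d) ^+ k != 1.
Proof. by move=> d0 hq k k0; rewrite -exprM hq // muln_gt0 d0. Qed.

(** * The cubic q-Pfaff-Saalschuetz sum *)

Definition rpoch (F : fieldType) (q : F) (m t : nat) : F :=
  if (t <= m)%N then (qpoch q q (m - t))^-1 else 0.

Definition cubic_term (F : fieldType) (q : F) (c m s : nat) : F :=
  qpoch (q ^+ 3) (q ^+ 3) (m + c - s - 1) * (q ^+ 3) ^+ (s ^ 2 + c * s)
    * rpoch q m (3 * s)
    / (qpoch (q ^+ 3) (q ^+ 3) s * qpoch (q ^+ 3) (q ^+ 3) (s + c)).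

(* The Wilf-Zeilberger certificate of [cubic_wz], found by hand from the ansatz
   G(s) = k Q^(-s) (1 - Q^s) (1 - Q^(s+c)) * (hypergeometric part), k free of s. *)
Definition cubic_cert (F : fieldType) (q : F) (c m s : nat) : F :=
  - (q ^+ m.+1 * qpoch (q ^+ 3) (q ^+ 3) (m + c - s)
       * (q ^+ 3) ^+ (s * s.-1 + c * s)
       * (1 - (q ^+ 3) ^+ s) * (1 - (q ^+ 3) ^+ (s + c)) * rpoch q m.+1 (3 * s)
     / (qpoch (q ^+ 3) (q ^+ 3) s * qpoch (q ^+ 3) (q ^+ 3) (s + c))).

(** The default 0 of [rpoch] beyond [t = m] plays the role of 1/(q;q)_(-1): at [t = m.+1] the factor
    1 - q^0 vanishes as well. *)
Lemma rpochS (F : fieldType) (q : F) (m t : nat) :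
  (forall k : nat, (0 < k)%N -> q ^+ k != 1) -> (t <= m.+1)%N ->
  rpoch q m t = (1 - q ^+ (m.+1 - t)) * rpoch q m.+1 t.
Proof.
move=> hq le_t; rewrite /rpoch le_t.
case: ltngtP le_t => // [lt_t|->] _; last by rewrite ltnn subnn expr0 subrr mul0r.
rewrite -ltnS lt_t subSn // qpochS invfM mulrCA mulfV ?mulr1 //.
by rewrite subr_eq0 eq_sym hq.
Qed.

Lemma rpochSS (F : fieldType) (q : F) (m t : nat) : rpoch q m.+1 t.+1 = rpoch q m t.
Proof. by []. Qed.

Lemma rpoch_gt (F : fieldType) (q : F) (m t : nat) : (m < t)%N -> rpoch q m t = 0.
Proof. by rewrite /rpoch ltnNge; case: leqP. Qed.

(** Moving [s] to [s.+1] shifts [t = 3 * s] by three. When [t.+3] leaves the range, one of the three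
    exponents is 0, so truncated subtraction does no harm. *)
Lemma rpoch_add3 (F : fieldType) (q : F) (m t : nat) :
  (forall k : nat, (0 < k)%N -> q ^+ k != 1) -> (t <= m.+1)%N ->
  rpoch q m.+1 t.+3 =
  (1 - q ^+ (m.+1 - t)) * (1 - q ^+ (m - t)) * (1 - q ^+ (m.-1 - t))
    * rpoch q m.+1 t.
Proof.
move=> hq le_t; have [h|h] := ltnP m.+1 t.+3; last first.
  case: m h le_t => [|[|m]] h le_t; [lia..|].
  rewrite !rpochSS (@rpochS _ q m) ?(@rpochS _ q m.+1) ?(@rpochS _ q m.+2) //; try lia.
  by rewrite /=; ring.
rewrite rpoch_gt //.
have : [|| (m.+1 - t == 0)%N, (m - t == 0)%N | (m.-1 - t == 0)%N] by lia.
by case/or3P => /eqP->; rewrite expr0 subrr; ring.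
Qed.

Lemma cubic_wz (F : fieldType) (q : F) (c m s : nat) :
  (forall k : nat, (0 < k)%N -> q ^+ k != 1) -> (0 < m + c)%N ->
  (1 - q ^+ m.+1) * (1 - q ^+ (m.+1 + 3 * c)) * cubic_term q c m.+1 s
  - (1 - q ^+ (2 * m + 3 * c)) * (1 - q ^+ (2 * m + 3 * c).+1) * cubic_term q c m s
  = cubic_cert q c m s.+1 - cubic_cert q c m s.
Proof.
move=> hq mc; rewrite /cubic_term /cubic_cert.
(* Past the support every one of the four terms contains a vanishing [rpoch]. *)
have [lt_ms|le_sm] := ltnP m.+1 (3 * s).
  by rewrite ?[rpoch _ _ _]rpoch_gt; try lia; ring.
have hQ := not_root_exp (isT : 0 < 3)%N hq.
(* From [3 * s <= m.+1] and [0 < m + c] follows [s < m + c], so these subtractions are exact. *)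
have E1 : (m.+1 + c - s - 1 = (m + c - s - 1).+1)%N by lia.
have E2 : (m + c - s = (m + c - s - 1).+1)%N by lia.
have E3 : (m + c - s.+1 = m + c - s - 1)%N by lia.
have E4 : (3 * s.+1 = (3 * s).+3)%N by lia.
have E5 : (s ^ 2 + c * s = (s * s.-1 + c * s) + s)%N by case: (s) => [|?]; nia.
have E6 : (s.+1 * s.+1.-1 + c * s.+1 = (s * s.-1 + c * s) + s + s + c)%N.
  by case: (s) => [|?]; nia.
have Es : qpoch (q ^+ 3) (q ^+ 3) s.+1 = _ := qpochS _ _.
have Es' : qpoch (q ^+ 3) (q ^+ 3) (s.+1 + c) = _ := qpochS _ (s + c).
have nz1 : 1 - (q ^+ 3) ^+ s.+1 != 0 by rewrite subr_eq0 eq_sym hQ.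
have nz2 : 1 - (q ^+ 3) ^+ (s + c).+1 != 0 by rewrite subr_eq0 eq_sym hQ.
have Ps := qpoch_neq0 s hQ; have Psc := qpoch_neq0 (s + c) hQ.
rewrite Es Es' E1 E3 E4 E5 E6 E2.
set M := (m + c - s - 1)%N; rewrite -/M in E1 E2 E3 *; rewrite subn1 /= qpochS.
rewrite (rpochS hq le_sm).
rewrite rpoch_add3 //.
have -> : (s.+1 + c = (s + c).+1)%N by [].
move: (rpoch _ _ _) (qpoch _ _ M) => D P.
(* With m + 1 = 3s + e, all powers become monomials in q, q^e, Q^s and Q^c, and the claim is an
   identity of rational functions. *)
have [e eE] : exists e, (m.+1 = 3 * s + e)%N by exists (m.+1 - 3 * s)%N; lia.
have X1 : q ^+ m.+1 = (q ^+ 3) ^+ s * q ^+ e by rewrite -exprM -exprD eE.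
have X2 : q ^+ (m.+1 + 3 * c) = (q ^+ 3) ^+ s * q ^+ e * (q ^+ 3) ^+ c.
  by rewrite exprD X1 (exprM _ 3 c).
have -> : (m.+1 - 3 * s = e)%N by lia.
(* For e = 0 the subtraction [m - 3 * s] truncates; there only the terms of [cubic_term q c m.+1 s]
   and [cubic_cert q c m s] survive. *)
case: e => [|e] in eE X1 X2 *.
  rewrite X1 X2 !exprD in nz1 nz2 *.
  by field; rewrite ?Ps ?Psc ?nz1 ?nz2.
have X3 : q ^+ (2 * m + 3 * c)
  = (q ^+ 3) ^+ s * (q ^+ 3) ^+ s * (q ^+ 3) ^+ c * q ^+ e * q ^+ e.
  by rewrite -!exprM -!exprD; congr (_ ^+ _); lia.
have X4 : (q ^+ 3) ^+ M.+1
  = (q ^+ 3) ^+ s * (q ^+ 3) ^+ s * (q ^+ 3) ^+ c * q ^+ e * q ^+ e * q ^+ e.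
  by rewrite -!exprM -!exprD; congr (_ ^+ _); lia.
rewrite X1 X2 X4 [q ^+ _.+1]exprS [in q ^+ (2 * m + 3 * c).+1]exprS X3.
have -> : (m - 3 * s = e)%N by lia.
have -> : (m.-1 - 3 * s = e.-1)%N by lia.
move: nz1 nz2; rewrite ![(q ^+ 3) ^+ _.+1]exprS !exprD => nz1 nz2.
move: (_ ^+ (s * s.-1)) (_ ^+ (c * s)) ((q ^+ 3) ^+ s) ((q ^+ 3) ^+ c) Ps Psc nz1 nz2.
move: (qpoch _ _ s) (qpoch _ _ (s + c)) => W W' Z1 Z2 y C W0 W'0 nz1 nz2.
by case: e {eE X1 X2 X3 X4} => [|e] /=; rewrite ?exprS ?expr0; field;
  rewrite W0 W'0 /= nz2 nz1.
Qed.

Lemma cubic_sum (F : fieldType) (q : F) (c m K : nat) :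
  (forall k : nat, (0 < k)%N -> q ^+ k != 1) -> (0 < m + c)%N -> (m < 3 * K)%N ->
  \sum_(0 <= s < K) cubic_term q c m s
  = qpoch q q (2 * m + 3 * c).-1 / (qpoch q q m * qpoch q q (m + 3 * c)).
Proof.
move=> hq; have hQ := not_root_exp (isT : 0 < 3)%N hq.
have nz k : 1 - q ^+ k.+1 != 0 by rewrite subr_eq0 eq_sym hq.
have pz k : qpoch q q k != 0 by apply: qpoch_neq0.
(* For m0 < 3 the factor 1/(q;q)_(m0-3s) leaves only s = 0. *)
have first_term : forall m0, (m0 < 3)%N -> (m0 < 3 * K)%N ->
    \sum_(0 <= s < K) cubic_term q c m0 s = cubic_term q c m0 0.
  case: K => // K m0 hm _; rewrite big_nat_recl // big1_seq ?addr0 // => s _.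
  rewrite /cubic_term rpoch_gt; last by lia.
  by rewrite mulr0 mul0r.
elim: m => [|m IH] mc mK.
  rewrite first_term // /cubic_term /rpoch muln0 leq0n !subn0 !add0n !qpoch0.
  rewrite expr0 invr1 !mulr1 !mul1r.
  case: c mc {first_term} => // c _; rewrite subn1 /= qpochS.
  have -> : (3 * c.+1 = (3 * c.+1).-1.+1)%N by lia.
  rewrite /= qpochS.
  have -> : ((3 * c.+1).-1.+1 = 3 * c.+1)%N by lia.
  rewrite -exprM !invfM !mulrA !mulfV ?mul1r //; exact: qpoch_neq0.
(* The induction hypothesis excludes m = c = 0, so the case of upper value 1 with c = 0 is computed
   directly. *)
have [m_c|mc0] := posnP (m + c)%N.
  move: m_c mK; rewrite {mc} => /eqP; rewrite addn_eq0 => /andP[/eqP m0 /eqP c0].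
  subst m c => mK; rewrite first_term //.
  rewrite /cubic_term /rpoch !muln0 leq0n !qpoch0 !addn0 !expr0 !mulr1 !mul1r invr1 mulr1.
  by rewrite muln1 /= invfM mulrA mulfV ?mul1r.
(* Both ends of the telescoping sum vanish: [rpoch] at s = K, the factor 1 - Q^0 at s = 0. *)
have wz : \sum_(0 <= s < K) (cubic_cert q c m s.+1 - cubic_cert q c m s) = 0.
  rewrite telescope_sumr // /cubic_cert (@rpoch_gt _ q m.+1 (3 * K)) ?muln0; last by lia.
  by rewrite !expr0 subrr; ring.
move: wz; under eq_bigr do rewrite -cubic_wz //.
rewrite sumrB -!mulr_sumr IH //; last by lia.
move/eqP; rewrite subr_eq0 => /eqP E.
have E1 : ((2 * m.+1 + 3 * c).-1 = (2 * m + 3 * c).-1.+2)%N by lia.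
have E2 : (m.+1 + 3 * c = (m + 3 * c).+1)%N by lia.
have E3 : ((2 * m + 3 * c).-1.+1 = 2 * m + 3 * c)%N by lia.
apply: (mulfI (mulf_neq0 (nz m) (nz (m + 3 * c)%N))).
rewrite -E2 E E1 E2 !qpochS E3.
by field; rewrite ?nz ?pz.
Qed.

(** * Bilateral sums of finite support *)

Lemma fsum_intE (R : nmodType) (B : nat) (f : int -> R) :
  (forall j : int, (B <= `|j|)%N -> f j = 0) ->
  \sum_(j \in [set: int]) f j = \sum_(0 <= i < B) (f (Posz i) + f (Negz i)).
Proof.
(* Since [Negz i] is -1 - i, each index pairs j = i with its image under j -> -1 - j. *)
move=> f0; pose s := map Posz (index_iota 0 B) ++ map Negz (index_iota 0 B).
rewrite (@fsbigE _ _ _ _ _ s) //.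
- by rewrite big_mkcond /= big_cat /= !big_map big_split /=; congr (_ + _);
    apply: eq_bigr => i _; rewrite in_setT.
- rewrite cat_uniq !map_inj_uniq ?iota_uniq; try by move=> ? ? [].
  by rewrite andbT; apply/hasPn => _ /mapP[i _ ->]; apply/mapP => -[].
- case=> i _; rewrite mem_cat negb_or => /andP[h1 h2]; apply: f0.
    by rewrite leqNgt; apply: contra h1 => h; rewrite map_f // mem_index_iota.
  by rewrite leqNgt; apply: contra h2 => h; rewrite map_f // mem_index_iota /=; lia.
Qed.

Lemma fsum_intD (R : nmodType) (B : nat) (f g : int -> R) :
  (forall j : int, (B <= `|j|)%N -> f j = 0) ->
  (forall j : int, (B <= `|j|)%N -> g j = 0) ->
  \sum_(j \in [set: int]) (f j + g j)
  = \sum_(j \in [set: int]) f j + \sum_(j \in [set: int]) g j.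
Proof.
move=> f0 g0; rewrite !(@fsum_intE _ B) //; last by move=> j h; rewrite f0 ?g0 ?addr0.
by rewrite -big_split; apply: eq_bigr => i _; rewrite addrACA.
Qed.

(** * q-binomial coefficients and Gauss-type alternating sums *)

Section QBinomial.
Variables (F : fieldType) (q : F).
Hypothesis hq : forall k : nat, (0 < k)%N -> q ^+ k != 1.

Lemma qbinom_nat (k l : nat) :
  qbinom q (k + l)%N k = qpoch q q (k + l) / (qpoch q q l * qpoch q q k).
Proof.
rewrite /qbinom.
by have -> : (k + l)%N%:Z - k%:Z = l%:Z by rewrite PoszD addrAC subrr add0r.
Qed.

Lemma qbinom_out (M N : int) : ~~ (0 <= N <= M) -> qbinom q M N = 0.
Proof. by rewrite /qbinom subr_ge0 andbC => /negbTE->. Qed.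

Lemma qbinom_sym (M N : int) : qbinom q M (M - N) = qbinom q M N.
Proof. by rewrite /qbinom subKr andbC [X in _ / X]mulrC. Qed.

Lemma qbinom0 (M : nat) : qbinom q M 0 = 1.
Proof.
by rewrite -[M]add0n qbinom_nat qpoch0 mulr1 mulfV // qpoch_neq0.
Qed.

Lemma qbinomn (M : nat) : qbinom q M M = 1.
Proof. by rewrite -qbinom_sym subrr qbinom0. Qed.

(** The integer power may have a negative exponent, but then the coefficient next to it is 0; so the
    rule holds for every integer [N]. *)
Lemma qbinom_pascal (M : nat) (N : int) :
  qbinom q M.+1 N = qbinom q M N + q ^ (M.+1%:Z - N) * qbinom q M (N - 1).
Proof.
case: N => [[|k]|k]; last by rewrite !qbinom_out; [rewrite mulr0 addr0 | lia..].
  by rewrite !qbinom0 qbinom_out ?mulr0 ?addr0.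
have -> : k.+1%:Z - 1 = k by lia.
case: (ltngtP M k) => [lt_Mk|lt_kM|->].
- by rewrite !qbinom_out; [rewrite mulr0 addr0 | lia..].
- have [l ->] : exists l, M = (k + l.+1)%N by exists (M - k.+1)%N; lia.
  have -> : (k + l.+1).+1%:Z - k.+1%:Z = l.+1%:Z by lia.
  rewrite -exprnP [qbinom _ _ k]qbinom_nat.
  have -> : (k + l.+1).+1 = (k.+1 + l.+1)%N by lia.
  rewrite qbinom_nat (_ : (k + l.+1)%N = (k.+1 + l)%N) ?qbinom_nat; last by lia.
  rewrite addnS [qpoch _ _ (_.+1)]qpochS -addnS.
  have := qpoch_neq0 k hq; have := qpoch_neq0 l hq.
  have nz d : 1 - q ^+ d.+1 != 0 by rewrite subr_eq0 eq_sym hq.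
  have := nz l; have := nz k => a1 a2 a3 a4.
  rewrite !qpochS.
  rewrite (_ : q ^+ (k.+1 + l.+1) = q ^+ k.+1 * q ^+ l.+1) ?exprD //.
  by field; rewrite a1 a2 a3 a4.
- by rewrite !qbinomn qbinom_out ?add0r ?subrr ?expr0z ?mul1r //; lia.
Qed.

Lemma qbinom_pascal_sym (M : nat) (N : int) :
  qbinom q M.+1 N = q ^ N * qbinom q M N + qbinom q M (N - 1).
Proof.
rewrite -qbinom_sym qbinom_pascal subKr addrC; congr (_ * _ + _).
  by rewrite -[RHS]qbinom_sym; congr qbinom; lia.
by rewrite -[RHS]qbinom_sym; congr qbinom; lia.
Qed.

(** The evaluation is needed for (e, M) = (1, 2r) and (0, 2r+1); keeping [e] and [M] independent
    lets the recursion pass through (0, 2r) and (1, 2r+1) too. *)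
Definition gauss_sum (e : int) (M r : nat) : F :=
  \sum_(j \in [set: int])
     (-1) ^ j * q ^ (j ^+ 2 + e * j) * qbinom q M (r%:Z - j).

Lemma expN1_opp (j : int) : (-1 : F) ^ (- j) = (-1) ^ j.
Proof. by rewrite -exprz_inv invrN1. Qed.

Lemma expN1_flip (j : int) : (-1 : F) ^ (-1 - j) = - (-1) ^ j.
Proof. by rewrite expfzDr ?oppr_eq0 ?oner_eq0 // expN1_opp exprN1 invrN1 mulN1r. Qed.

Lemma oppr_bij : bijective (fun j : int => - j).
Proof. by exists (fun j : int => - j) => j; rewrite opprK. Qed.

Lemma flip_bij : bijective (fun j : int => -1 - j).
Proof. by exists (fun j : int => -1 - j) => j; rewrite subKr. Qed.

Lemma gauss_term0 (e : int) (M r : nat) (j : int) : (M + r < `|j|)%N ->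
  (-1) ^ j * q ^ (j ^+ 2 + e * j) * qbinom q M (r%:Z - j) = 0.
Proof. by move=> h; rewrite qbinom_out ?mulr0 //; lia. Qed.

Hypothesis q0 : q != 0.

(* The involution j -> -1 - j preserves the term up to its sign. *)
Lemma gauss_sum_odd1 (r : nat) : gauss_sum 1 (2 * r).+1 r = 0.
Proof.
rewrite /gauss_sum (@fsum_intE _ ((2 * r).+1 + r).+1); last exact: gauss_term0.
rewrite big1 // => i _.
have -> : Negz i = -1 - i%:Z by lia.
rewrite expN1_flip -[qbinom q _ (_ - (-1 - _))]qbinom_sym.
have -> : (-1 - i%:Z) ^+ 2 + 1 * (-1 - i%:Z) = i%:Z ^+ 2 + 1 * i%:Z by ring.
have -> : (2 * r).+1%:Z - (r%:Z - (-1 - i%:Z)) = r%:Z - i%:Z by lia.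
by ring.
Qed.

(** Pascal's rule splits the sum; the substitution j -> -1 - j turns the second half into the sum
    with e = 1. *)
Lemma gauss_sum_odd0 (r : nat) :
  gauss_sum 0 (2 * r).+1 r = gauss_sum 0 (2 * r) r - q ^+ r.+1 * gauss_sum 1 (2 * r) r.
Proof.
rewrite {1}/gauss_sum; under eq_fsbigr do rewrite qbinom_pascal // mulrDr.
rewrite (@fsum_intD _ (2 * r + r).+2).
- congr (_ + _); rewrite (reindex_fsbigT _ _ flip_bij) /gauss_sum.
  rewrite mulr_fsumr -[RHS]mulrN1 mulr_fsuml.
  apply: eq_fsbigr => j _.
  rewrite expN1_flip -[qbinom q _ (_ - 1)]qbinom_sym.
  have -> : (2 * r)%N%:Z - (r%:Z - (-1 - j) - 1) = r%:Z - j by lia.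
  rewrite [q ^+ _]exprnP mulrA -[X in X * _ = _]mulrA -expfzDr //.
  rewrite [RHS]mulrN1 mulrA [q ^ _ * _]mulrCA -expfzDr // -!mulNr; congr (- _ * q ^ _ * _).
  by rewrite !intS PoszM; ring.
- by move=> j h; rewrite qbinom_out ?mulr0 //; lia.
- by move=> j h; rewrite qbinom_out ?mulr0 //; lia.
Qed.

Lemma gauss_sum_refl (r : nat) :
  \sum_(j \in [set: int])
     (-1) ^ j * q ^ (j ^+ 2 + 0 * j) * qbinom q (2 * r).+1 (r.+1%:Z - j)
  = gauss_sum 0 (2 * r).+1 r.
Proof.
rewrite (reindex_fsbigT _ _ oppr_bij); apply: eq_fsbigr => j _.
rewrite expN1_opp -[qbinom _ _ _]qbinom_sym; congr (_ * q ^ _ * qbinom _ _ _); ring.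
Qed.

(** In Pascal's rule the first half is recentred by j -> -j, and the second is a multiple of the
    vanishing sum for (1, 2r+1). *)
Lemma gauss_sum_even0 (r : nat) :
  gauss_sum 0 (2 * r.+1) r.+1 = gauss_sum 0 (2 * r).+1 r.
Proof.
rewrite mulnS {1}/gauss_sum; under eq_fsbigr do rewrite qbinom_pascal // mulrDr.
rewrite (@fsum_intD _ (3 * r + 3)).
- rewrite gauss_sum_refl -[RHS]addr0; congr (_ + _).
  rewrite -[RHS](mulr0 (q ^+ r.+1)) -[in RHS](gauss_sum_odd1 r) mulr_fsumr; apply: eq_fsbigr => j _.
  have -> : r.+1%:Z - j - 1 = r%:Z - j by lia.
  rewrite [q ^+ _]exprnP !mulrA [q ^ r.+1 * _]mulrC.
  rewrite -[in LHS](mulrA ((-1) ^ j)) -[in RHS](mulrA ((-1) ^ j)) -!expfzDr //.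
  congr (_ * q ^ _ * _).
  by rewrite !intS PoszM; ring.
- by move=> j h; rewrite qbinom_out ?mulr0 //; lia.
- by move=> j h; rewrite qbinom_out ?mulr0 //; lia.
Qed.

(** The other Pascal rule is chosen because its factor q^(r+1-j) cancels the linear term j of the
    exponent; the second half vanishes again. *)
Lemma gauss_sum_even1 (r : nat) :
  gauss_sum 1 (2 * r.+1) r.+1 = q ^+ r.+1 * gauss_sum 0 (2 * r).+1 r.
Proof.
rewrite mulnS {1}/gauss_sum; under eq_fsbigr do rewrite qbinom_pascal_sym // mulrDr.
rewrite (@fsum_intD _ (3 * r + 3)).
- rewrite -gauss_sum_refl -[RHS]addr0 mulr_fsumr; congr (_ + _).
    apply: eq_fsbigr => j _; rewrite [q ^+ _]exprnP !mulrA [q ^ r.+1 * _]mulrC.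
    rewrite -[in LHS](mulrA ((-1) ^ j)) -[in RHS](mulrA ((-1) ^ j)) -!expfzDr //.
    by congr (_ * q ^ _ * _); ring.
  rewrite -[RHS](gauss_sum_odd1 r); apply: eq_fsbigr => j _.
  by congr (_ * qbinom _ _ _); lia.
- by move=> j h; rewrite qbinom_out ?mulr0 //; lia.
- by move=> j h; rewrite qbinom_out ?mulr0 //; lia.
Qed.

Lemma gauss_sum00 (e : int) : gauss_sum e 0 0 = 1.
Proof.
rewrite /gauss_sum (@fsum_intE _ 1); last by move=> j h; rewrite qbinom_out ?mulr0 //; lia.
rewrite big_nat1 [qbinom q _ (_ - Negz 0)]qbinom_out //.
by rewrite subr0 qbinom0 mulr0 expr0n /= mulr0 !addr0 !expr0z !mulr1.
Qed.

Lemma gauss_sum_even1E (r : nat) :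
  gauss_sum 1 (2 * r) r = q ^+ r * gauss_sum 0 (2 * r) r.
Proof.
case: r => [|r]; first by rewrite muln0 !gauss_sum00 mulr1.
by rewrite gauss_sum_even1 gauss_sum_even0.
Qed.

Lemma gauss_sum_odd0E (r : nat) :
  gauss_sum 0 (2 * r).+1 r = (1 - q ^+ (2 * r).+1) * gauss_sum 0 (2 * r) r.
Proof.
by rewrite gauss_sum_odd0 gauss_sum_even1E mulrA -exprD addSn addnn -mul2n mulrBl mul1r.
Qed.

(** The recurrences identify the Gauss sum with (q;q^2)_r, the odd-exponent part of (q;q)_(2r). *)
Lemma qpoch_even (r : nat) :
  qpoch q q (2 * r) = gauss_sum 0 (2 * r) r * qpoch (q ^+ 2) (q ^+ 2) r.
Proof.
elim: r => [|r IH]; first by rewrite muln0 gauss_sum00 !qpoch0 mulr1.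
rewrite gauss_sum_even0 gauss_sum_odd0E mulnS !qpochS IH -exprM mulnS.
by ring.
Qed.

Lemma qpoch_odd (r : nat) :
  qpoch q q (2 * r).+1 = gauss_sum 0 (2 * r).+1 r * qpoch (q ^+ 2) (q ^+ 2) r.
Proof. by rewrite qpochS qpoch_even gauss_sum_odd0E; ring. Qed.

End QBinomial.

(** * The inner sum over r for fixed j *)

Section Kernel.
Variables (F : fieldType) (q : F) (n a : nat).
Hypotheses (hq : forall k : nat, (0 < k)%N -> q ^+ k != 1) (n0 : (0 < n)%N) (a1 : (a <= 1)%N).

(** The left-hand summand after the Gauss expansion, stripped of (-1)^j Q^(j^2+(1-a)j). The factor
    Q^((1-a)r) has been absorbed by the Gauss evaluation, leaving Q^(r^2+ar). *)
Definition kernel_term (j : int) (r : nat) : F :=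
  qpoch (q ^+ 3) (q ^+ 3) (n - r - 1) * (1 - q ^+ (2 * n + a))
    * (q ^+ 3) ^+ (r ^ 2 + a * r) / qpoch q q (n - 3 * r - a)
    * qbinom (q ^+ 3) (2 * r + a)%N (r%:Z - j)
    / qpoch (q ^+ 3) (q ^+ 3) (2 * r + a).

Lemma kernel_sum_nat (j : nat) :
  \sum_(0 <= r < n.+1 | (3 * r <= n - a)%N) kernel_term j r
  = (q ^+ 3) ^+ (j ^ 2 + a * j) * qbinom q (2 * n + a)%N (n%:Z - 3 * j%:Z - a%:Z).
Proof.
have hQ := not_root_exp (isT : 0 < 3)%N hq.
have [lt_nj|le_jn] := ltnP (n - a) (3 * j).
  rewrite [in RHS]qbinom_out ?mulr0; last by lia.
  rewrite big1 // => r hr; rewrite /kernel_term qbinom_out; last by lia.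
  by rewrite mulr0 mul0r.
pose m := (n - 3 * j - a)%N; pose c := (2 * j + a)%N.
have mc : (0 < m + c)%N by lia.
have mK : (m < 3 * (n.+1 - j))%N by lia.
(* As 2m + 3c = 2n + a, the factor 1 - q^(2n+a) completes (q;q)_(2m+3c-1) to the numerator of the
   q-binomial coefficient. *)
have E2n : (2 * n + a = (2 * m + 3 * c).-1.+1)%N by lia.
rewrite [in RHS](_ : (2 * n + a)%N = (m + (m + 3 * c))%N); last by lia.
rewrite [in RHS](_ : n%:Z - 3 * j%:Z - a%:Z = m%:Z); last by lia.
rewrite qbinom_nat (_ : (m + (m + 3 * c) = (2 * m + 3 * c).-1.+1)%N); last by lia.
rewrite qpochS -E2n.
transitivity ((q ^+ 3) ^+ (j ^ 2 + a * j) * (1 - q ^+ (2 * n + a))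
    * \sum_(0 <= s < n.+1 - j) cubic_term q c m s); last first.
  rewrite cubic_sum //; field.
  by rewrite !qpoch_neq0.
(* Terms with r < j vanish, since then r - j is negative; the rest is reindexed by r = s + j. *)
rewrite big_mkcond /= (@big_cat_nat _ _ _ j) //=; last by lia.
rewrite big1_seq ?add0r; last first.
  move=> r /andP[_]; rewrite mem_index_iota => /andP[_ lt_rj].
  case: ifP => // _; rewrite /kernel_term qbinom_out; last by lia.
  by rewrite mulr0 mul0r.
rewrite -{1}[j]add0n big_addn mulr_sumr; apply: eq_big_nat => s hs.
rewrite /cubic_term; case: leqP => h; last by rewrite rpoch_gt; [ring | lia].
rewrite /rpoch (_ : 3 * s <= m)%N; last by lia.
rewrite /kernel_term (_ : (s + j)%:Z - j%:Z = s%:Z); last by lia.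
rewrite (_ : (2 * (s + j) + a)%N = (s + (s + c))%N); last by lia.
rewrite qbinom_nat (_ : (n - (s + j) - 1 = m + c - s - 1)%N); last by lia.
rewrite (_ : (n - 3 * (s + j) - a = m - 3 * s)%N); last by lia.
rewrite (_ : ((s + j) ^ 2 + a * (s + j) = (j ^ 2 + a * j) + (s ^ 2 + c * s))%N);
  last by rewrite /c; ring.
rewrite [(q ^+ 3) ^+ (_ + (s ^ 2 + _))]exprD; field.
by rewrite !qpoch_neq0.
Qed.

(** The reflection j -> -a - j fixes j^2 + aj and, by symmetry of the q-binomial coefficients, both
    sides; it reduces negative j to the natural case. *)
Lemma kernel_sum (j : int) : q != 0 ->
  \sum_(0 <= r < n.+1 | (3 * r <= n - a)%N) kernel_term j r
  = (q ^+ 3) ^ (j ^+ 2 + a%:Z * j)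
      * qbinom q (2 * n + a)%N (n%:Z - 3 * j - a%:Z).
Proof.
move=> q0.
have nat_case (k : nat) : \sum_(0 <= r < n.+1 | (3 * r <= n - a)%N) kernel_term k r
  = (q ^+ 3) ^ (k%:Z ^+ 2 + a%:Z * k%:Z)
      * qbinom q (2 * n + a)%N (n%:Z - 3 * k%:Z - a%:Z).
  by rewrite kernel_sum_nat exprnP; congr (_ ^ _ * _); lia.
have [j0|j0] := leP 0 j.
  by have -> : j = `|j|%N by lia.
have [k ->] : exists k : nat, j = - a%:Z - k%:Z by exists (`|j| - a)%N; lia.
have -> : (- a%:Z - k%:Z) ^+ 2 + a%:Z * (- a%:Z - k%:Z) = k%:Z ^+ 2 + a%:Z * k%:Z by ring.
rewrite -[qbinom q _ _]qbinom_sym.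
rewrite (_ : _ - (n%:Z - _ - _) = n%:Z - 3 * k%:Z - a%:Z); last by lia.
rewrite -nat_case; apply: eq_bigr => r _; rewrite /kernel_term.
rewrite -[qbinom _ _ (r%:Z - (_ - _))]qbinom_sym; congr (_ * qbinom _ _ _ / _).
by lia.
Qed.

End Kernel.

(** * Assembly: Gauss expansion and exchange of the sums *)

Lemma gauss_sumE (F : fieldType) (q : F) (a r : nat) :
  (forall k : nat, (0 < k)%N -> q ^+ k != 1) -> q != 0 -> (a <= 1)%N ->
  gauss_sum q (1 - a%:Z) (2 * r + a) r * qpoch (q ^+ 2) (q ^+ 2) r
  = q ^+ ((1 - a) * r) * qpoch q q (2 * r + a).
Proof.
move=> hq q0; case: a => [|[|//]] _.
  by rewrite addn0 subr0 subn0 mul1n gauss_sum_even1E // qpoch_even // mulrA.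
by rewrite addn1 subrr subnn mul0n mul1r qpoch_odd.
Qed.

Lemma qpoch_zero (F : fieldType) (L : nat) : qpoch (0 : F) 0 L = 1.
Proof. by elim: L => [|L IH]; rewrite ?qpoch0 // qpochS IH expr0n subr0 mulr1. Qed.

Theorem theorem1p9 (F : fieldType) (q : F)
  (hq : forall k : nat, (0 < k)%N -> q ^+ k != 1)
  (n a : nat) (hn : (0 < n)%N) (ha : a = 0%N \/ a = 1%N) :
  \sum_(0 <= j < n.+1 | (3 * j <= n - a)%N)
     (qpoch (q ^+ 3) (q ^+ 3) (n - j - 1) * (1 - q ^+ (2 * n + a))
        * q ^+ (3 * j ^ 2 + 3 * j))
     / (qpoch q q (n - 3 * j - a) * qpoch (q ^+ 6) (q ^+ 6) j)
  = \sum_(j \in [set: int])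
     (-1) ^ j * q ^ (6 * j ^+ 2 + 3 * j)
       * qbinom q (2 * n%:Z + a%:Z) (n%:Z - 3 * j - a%:Z).
Proof.
have a1 : (a <= 1)%N by case: ha => ->.
rewrite (_ : 2 * n%:Z + a%:Z = (2 * n + a)%N); last by lia.
(* [hq] allows q = 0, where negative powers misbehave; there only j = 0 contributes, and both sides
   equal 1. *)
have [q0|q0] := eqVneq q 0.
  rewrite (@fsum_intE _ 1); last first.
    move=> j h; rewrite q0 exp0rz; case: eqP; last by rewrite mulr0 mul0r.
    by nia.
  rewrite big_nat1 big_mkcond big_nat_recl // big1_seq; last first.
    by move=> j _; case: ifP => // _; rewrite q0 [0 ^+ (3 * _ + _)]exprD
       [0 ^+ (3 * _.+1)]expr0n !mulr0 mul0r.
  rewrite muln0 leq0n !subn0 /= !addr0 !mulr0.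
  rewrite [X in _ = _ + _ * X * _](_ : _ = 0); last by rewrite q0 exp0rz.
  rewrite mulr0 mul0r addr0 !expr0z !mul1r q0 !expr0n /= !qpoch_zero.
  rewrite (_ : (2 * n + a == 0)%N = false); last by lia.
  rewrite (_ : n%:Z - a%:Z = (n - a)%N%:Z); last by lia.
  rewrite (_ : (2 * n + a = (n - a) + (n + 2 * a))%N); last by lia.
  by rewrite qbinom_nat !qpoch_zero subr0 !mulr1.
have hQ := not_root_exp (isT : 0 < 3)%N hq.
have hQ2 := not_root_exp (isT : 0 < 2)%N hQ.
have Q0 : q ^+ 3 != 0 by rewrite expf_neq0.
(* The bound [n + 3] lies beyond the support in j on both sides, so only finite sums are
   exchanged. *)
transitivity (\sum_(0 <= r < n.+1 | (3 * r <= n - a)%N)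
    \sum_(0 <= i < n + 3)
      ((-1) ^ Posz i * (q ^+ 3) ^ (Posz i ^+ 2 + (1 - a%:Z) * Posz i)
           * kernel_term q n a i r
       + (-1) ^ Negz i * (q ^+ 3) ^ (Negz i ^+ 2 + (1 - a%:Z) * Negz i)
           * kernel_term q n a (Negz i) r)).
  apply: eq_bigr => r hr.
  rewrite -(@fsum_intE _ _ (fun j : int =>
    (-1) ^ j * (q ^+ 3) ^ (j ^+ 2 + (1 - a%:Z) * j) * kernel_term q n a j r)); last first.
    move=> j hj; rewrite /kernel_term qbinom_out; last by lia.
    by rewrite mulr0 mul0r mulr0.
  transitivity (qpoch (q ^+ 3) (q ^+ 3) (n - r - 1) * (1 - q ^+ (2 * n + a))
    * (q ^+ 3) ^+ (r ^ 2 + a * r) / qpoch q q (n - 3 * r - a)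
    / qpoch (q ^+ 3) (q ^+ 3) (2 * r + a)
    * gauss_sum (q ^+ 3) (1 - a%:Z) (2 * r + a) r); last first.
    rewrite /gauss_sum mulr_fsumr; apply: eq_fsbigr => j _; rewrite /kernel_term.
    by field; rewrite !qpoch_neq0.
  have P2 : qpoch (q ^+ 6) (q ^+ 6) r != 0.
    by rewrite (exprM _ 3 2) qpoch_neq0.
  (* Clearing (q^6;q^6)_r = (Q^2;Q^2)_r exposes the product evaluated by [gauss_sumE]. *)
  apply: (mulIf P2); rewrite -[RHS]mulrA [in RHS](exprM q 3 2) gauss_sumE //.
  rewrite (_ : (3 * r ^ 2 + 3 * r = 3 * (r ^ 2 + a * r) + 3 * ((1 - a) * r))%N); last by nia.
  rewrite [q ^+ (3 * _ + _)]exprD !(exprM q 3).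
  by field; rewrite P2 !qpoch_neq0.
rewrite exchange_big /= (@fsum_intE _ (n + 3)); last first.
  by move=> j hj; rewrite qbinom_out ?mulr0 //; lia.
(* The exponents combine as Q^(j^2+(1-a)j) Q^(j^2+aj) = q^(6j^2+3j). *)
have E (j : int) : (-1) ^ j * q ^ (6 * j ^+ 2 + 3 * j)
    * qbinom q (2 * n + a)%N (n%:Z - 3 * j - a%:Z)
  = \sum_(0 <= r < n.+1 | (3 * r <= n - a)%N)
      (-1) ^ j * (q ^+ 3) ^ (j ^+ 2 + (1 - a%:Z) * j) * kernel_term q n a j r.
  rewrite -mulr_sumr kernel_sum // mulrA -[in RHS](mulrA ((-1) ^ j)) -expfzDr //.
  by rewrite (exprnP q 3) exprz_exp; congr (_ * q ^ _ * _); ring.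
by apply: eq_bigr => i _; rewrite !E -big_split.
Qed.
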